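(* Let $AP$ be a set of atomic propositions and $Ag$ a finite set of agents. Global and local announcement logic (GLAL), with language $\mathcal{L}_{glal}$, is strictly more expressive than public announcement logic (PAL, with common knowledge), with language $\mathcal{L}_{pal}$. That is: (1) every formula of $\mathcal{L}_{pal}$ is equivalent to some formula of $\mathcal{L}_{glal}$; and (2) there is a formula of $\mathcal{L}_{glal}$ that is not equivalent to any formula of $\mathcal{L}_{pal}$. Here two formulas are equivalent if they are satisfied at exactly the same pointed models $(\mathcal{M},w)$.
   Context: Languages. $AP$ is a set of atoms and $Ag$ a finite set of agents. For $p\in AP$ and $A\subseteq Ag$, the formulas of $\mathcal{L}_{glal}$ are $\psi ::= p \mid \neg\psi \mid \psi\land\psi \mid C_A\psi \mid [\psi]^+_A\psi \mid [\psi]^-_A\psi$, and the formulas of $\mathcal{L}_{pal}$ are $\psi ::= p \mid \neg\psi \mid \psi\land\psi \mid C_A\psi \mid [\psi]\psi$. Models. A (Kripke) model is $\mathcal{M}=\langle W,\{R_a\}_{a\in Ag},V\rangle$ with $W$ a set of worlds, each $R_a$ an equivalence relation on $W$, and $V:AP\to 2^W$. A pointed model is a pair $(\mathcal{M},w)$ with $w\in W$. For $w\in W$, $R_a(w)=\{w' : R_a(w,w')\}$; for $A\subseteq Ag$, $R^C_A=(\bigcup_{a\in A}R_a)^*$ is the reflexive and transitive closure of the union, and $R^C_A(w)=\{w' : R^C_A(w,w')\}$. Semantics. The satisfaction set $[\![\varphi]\!]_{\mathcal{M}}\subseteq W$ is defined by: $[\![p]\!]_{\mathcal{M}}=V(p)$;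 $[\![\neg\psi]\!]_{\mathcal{M}}=W\setminus[\![\psi]\!]_{\mathcal{M}}$; $[\![\psi\land\psi']\!]_{\mathcal{M}}=[\![\psi]\!]_{\mathcal{M}}\cap[\![\psi']\!]_{\mathcal{M}}$; $[\![C_A\psi]\!]_{\mathcal{M}}=\{w : R^C_A(w)\subseteq[\![\psi]\!]_{\mathcal{M}}\}$; for $\star\in\{+,-\}$, $[\![[\psi]^\star_A\psi']\!]_{\mathcal{M}}=\{w : \text{if } w\in[\![\psi]\!]_{\mathcal{M}} \text{ then } w\in[\![\psi']\!]_{\mathcal{M}^\star_{(w,\psi,A)}}\}$; and $[\![[\psi]\psi']\!]_{\mathcal{M}}=\{w : \text{if } w\in[\![\psi]\!]_{\mathcal{M}} \text{ then } w\in[\![\psi']\!]_{\mathcal{M}_\psi}\}$. The refinements $\mathcal{M}^-_{(w,\psi,A)}$ and $\mathcal{M}^+_{(w,\psi,A)}$ have the same worlds and valuation as $\mathcal{M}$ and relations $R^-_b=R^+_b=R_b$ for $b\notin A$, while for $a\in A$: $R^-_a(v)=R_a(v)\cap[\![\psi]\!]_{\mathcal{M}}$ if $v\in R_a(w)\cap[\![\psi]\!]_{\mathcal{M}}$; $R^-_a(v)=R_a(v)\cap[\![\neg\psi]\!]_{\mathcal{M}}$ if $v\in R_a(w)\cap[\![\neg\psi]\!]_{\mathcal{M}}$; $R^-_a(v)=R_a(v)$ otherwise; and $R^+_a(v)$ is defined by the same three cases with $R_a(w)$ replaced by $R^C_A(w)$ in the case conditions. The model $\mathcal{M}_\psi$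 is the restriction of $\mathcal{M}$ to $[\![\psi]\!]_{\mathcal{M}}$: its worlds are $W\cap[\![\psi]\!]_{\mathcal{M}}$, its relations $R_a\cap([\![\psi]\!]_{\mathcal{M}}\times[\![\psi]\!]_{\mathcal{M}})$, its valuation $p\mapsto V(p)\cap[\![\psi]\!]_{\mathcal{M}}$. We write $(\mathcal{M},w)\models\varphi$ (''$\varphi$ is satisfied at $(\mathcal{M},w)$'') for $w\in[\![\varphi]\!]_{\mathcal{M}}$.
   Formalization: Part (2) is stated for a nonempty set of atoms and at least two agents; without atoms there are no formulas, and with at most one agent both logics are equally expressive, so (2) fails there. *)

(* Defs.v *)
From Stdlib Require Import Relations.
From mathcomp Require Import all_boot.
From mathcomp Require Import boolp classical_sets.

Set Implicit Arguments.
Unset Strict Implicit.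
Unset Printing Implicit Defensive.

Local Open Scope classical_set_scope.

Inductive glal (AP : Type) (Ag : finType) : Type :=
| GAtom of AP
| GNeg of glal AP Ag
| GAnd of glal AP Ag & glal AP Ag
| GCommon of {set Ag} & glal AP Ag
| GGlobal of {set Ag} & glal AP Ag & glal AP Ag   (* [psi]^+_A chi *)
| GLocal of {set Ag} & glal AP Ag & glal AP Ag.   (* [psi]^-_A chi *)

Inductive pal (AP : Type) (Ag : finType) : Type :=
| PAtom of AP
| PNeg of pal AP Ag
| PAnd of pal AP Ag & pal AP Ag
| PCommon of {set Ag} & pal AP Ag
| PPublic of pal AP Ag & pal AP Ag.               (* [psi]chi *)

(* [acc M a w] is the set R_a(w). *)
Record model (AP : Type) (Ag : finType) : Type := Model {
  world : Type;
  acc : Ag -> world -> set world;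
  acc_equiv : forall a, equivalence world (acc a);
  valuation : AP -> set world }.

Arguments acc {AP Ag} m a w.
Arguments acc_equiv {AP Ag} m a.
Arguments valuation {AP Ag} m p.

(* [common_acc M A w] is the set R^C_A(w); for A = set0 it is {w}. *)
Definition common_acc (AP : Type) (Ag : finType) (M : model AP Ag)
    (A : {set Ag}) : world M -> set (world M) :=
  clos_refl_trans (world M) (fun v u => exists2 a, a \in A & acc M a v u).

(* [S a] is the region where the relation of agent a is split along P: it is
   R_a(w) for a local announcement and R^C_A(w) for a global one. *)
Definition refined_acc (AP : Type) (Ag : finType) (M : model AP Ag)
    (A : {set Ag}) (S : Ag -> set (world M)) (P : set (world M))
    (a : Ag) (v : world M) : set (world M) :=
  if a \in A then
    if v \in S a `&` P then acc M a v `&` P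
    else if v \in S a `&` ~` P then acc M a v `&` ~` P
    else acc M a v
  else acc M a v.

Lemma refined_acc_equiv (AP : Type) (Ag : finType) (M : model AP Ag)
    (A : {set Ag}) (S : Ag -> set (world M)) (P : set (world M)) :
  (forall a, a \in A -> forall v u, acc M a v u -> S a v -> S a u) ->
  forall a, equivalence (world M) (refined_acc A S P a).
Proof.
move=> Sclosed a; have [Rr Rt Rs] := acc_equiv M a.
have [aA|aA] := boolP (a \in A); last first.
  by split; rewrite /refined_acc (negbTE aA).
have splitE v u : refined_acc A S P a v u <->
    acc M a v u /\ (S a v -> (P v <-> P u)).
  rewrite /refined_acc aA.
  case: ifPn => [/set_mem[Sv Pv]|/negP nSP].
    by split=> [[? ?]|[? /(_ Sv)[H _]]]; split=> //; exact: H.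
  case: ifPn => [/set_mem[Sv nPv]|/negP nSnP].
    split=> [[vu nPu]|[vu /(_ Sv)[_ H]]]; first by split.
    by split=> // /H.
  split=> [vu|[]//]; split=> // Sv; exfalso.
  have [Pv|nPv] := pselect (P v).
    by apply: nSP; apply: mem_set.
  by apply: nSnP; apply: mem_set.
split.
- by move=> v; apply/splitE; split=> //; exact: Rr.
- move=> v u t /splitE[vu Pvu] /splitE[ut Put]; apply/splitE.
  split; first exact: Rt vu ut.
  move=> Sv; have Su := Sclosed a aA _ _ vu Sv.
  exact: iff_trans (Pvu Sv) (Put Su).
- move=> v u /splitE[vu Pvu]; apply/splitE; split; first exact: Rs.
  by move=> Su; apply: iff_sym; apply: Pvu; apply: Sclosed Su => //; exact: Rs.
Qed.

Lemma common_acc_closed (AP : Type) (Ag : finType) (M : model AP Ag)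
    (A : {set Ag}) (w : world M) (a : Ag) : a \in A ->
  forall v u, acc M a v u -> common_acc A w v -> common_acc A w u.
Proof.
move=> aA v u vu wv; apply: rt_trans wv _.
by apply: rt_step; exists a.
Qed.

Lemma acc_closed (AP : Type) (Ag : finType) (M : model AP Ag)
    (w : world M) (a : Ag) v u : acc M a v u -> acc M a w v -> acc M a w u.
Proof. by have [_ Rt _] := acc_equiv M a => vu wv; exact: Rt wv vu. Qed.

Definition global_refinement (AP : Type) (Ag : finType) (M : model AP Ag)
    (w : world M) (P : set (world M)) (A : {set Ag}) : model AP Ag :=
  {| world := world M;
     acc := refined_acc A (fun _ => common_acc A w) P;
     acc_equiv := refined_acc_equiv P (@common_acc_closed _ _ M A w);
     valuation := valuation M |}.

Definition local_refinement (AP : Type) (Ag : finType) (M : model AP Ag)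
    (w : world M) (P : set (world M)) (A : {set Ag}) : model AP Ag :=
  {| world := world M;
     acc := refined_acc A (fun a => acc M a w) P;
     acc_equiv := refined_acc_equiv P (fun a (_ : a \in A) => @acc_closed _ _ M w a);
     valuation := valuation M |}.

Lemma restriction_equiv (AP : Type) (Ag : finType) (M : model AP Ag)
    (P : set (world M)) (a : Ag) :
  equivalence {v : world M | P v} (fun v u => acc M a (sval v) (sval u)).
Proof.
have [Rr Rt Rs] := acc_equiv M a; split.
- by move=> v; exact: Rr.
- by move=> v u t; exact: Rt.
- by move=> v u; exact: Rs.
Qed.

Definition restriction (AP : Type) (Ag : finType) (M : model AP Ag)
    (P : set (world M)) : model AP Ag :=
  {| world := {v : world M | P v};
     acc := fun a v u => acc M a (sval v) (sval u);
     acc_equiv := restriction_equiv P;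
     valuation := fun p v => valuation M p (sval v) |}.

Unset Implicit Arguments.

Fixpoint glal_sat {AP : Type} {Ag : finType} (phi : glal AP Ag)
    (M : model AP Ag) : set (world M) :=
  match phi with
  | GAtom p => valuation M p
  | GNeg psi => ~` glal_sat psi M
  | GAnd psi chi => glal_sat psi M `&` glal_sat chi M
  | GCommon A psi => [set w | common_acc A w `<=` glal_sat psi M]
  | GGlobal A psi chi => [set w | glal_sat psi M w ->
      glal_sat chi (global_refinement w (glal_sat psi M) A) w]
  | GLocal A psi chi => [set w | glal_sat psi M w ->
      glal_sat chi (local_refinement w (glal_sat psi M) A) w]
  end.

Fixpoint pal_sat {AP : Type} {Ag : finType} (phi : pal AP Ag)
    (M : model AP Ag) : set (world M) :=
  match phi with
  | PAtom p => valuation M p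
  | PNeg psi => ~` pal_sat psi M
  | PAnd psi chi => pal_sat psi M `&` pal_sat chi M
  | PCommon A psi => [set w | common_acc A w `<=` pal_sat psi M]
  | PPublic psi chi => [set w | forall h : pal_sat psi M w,
      pal_sat chi (restriction (pal_sat psi M)) (exist _ w h)]
  end.

Definition equivalent {AP : Type} {Ag : finType}
    (phi : pal AP Ag) (psi : glal AP Ag) : Prop :=
  forall (M : model AP Ag) (w : world M), pal_sat phi M w <-> glal_sat psi M w.

(* Main.v *)
Require Import Defs.
From Stdlib Require Import Relations.
From mathcomp Require Import all_boot.
From mathcomp Require Import boolp classical_sets.

(** PAL embeds in GLAL by reading the announcement [psi]chi as the global
    announcement [psi]^+_Ag chi: seen from a world of psi, the models M_psi and
    M^+_(w,psi,Ag) have the same generated submodel, and PAL formulas are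
    bisimulation invariant. The inclusion is strict because local announcements
    are not bisimulation invariant: they split only the a-class of the current
    world, so unfolding a model can leave an a-class unsplit which is bisimilar
    to the one being split. *)

Set Implicit Arguments.
Unset Strict Implicit.
Unset Printing Implicit Defensive.

Local Open Scope classical_set_scope.

Section Bisimulation.
Context {AP : Type} {Ag : finType}.
Implicit Types M N : model AP Ag.

Definition simulation M N (Z : world M -> world N -> Prop) :=
  forall a w u w', Z w w' -> acc M a w u -> exists2 u', acc N a w' u' & Z u u'.

Definition bisimulation M N (Z : world M -> world N -> Prop) :=
  [/\ forall p w w', Z w w' -> (valuation M p w <-> valuation N p w'),
      simulation Z & simulation (fun w' w => Z w w')].

Lemma simulation_common M N (Z : world M -> world N -> Prop) A w u :
  simulation Z -> common_acc A w u ->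
  forall w', Z w w' -> exists2 u', common_acc A w' u' & Z u u'.
Proof.
move=> simZ; elim=> {w u} [w u [a aA wu]|w|w v u _ IHv _ IHu] w' Zw.
- have [u' wu' Zu] := simZ a w u w' Zw wu.
  by exists u' => //; apply: rt_step; exists a.
- by exists w' => //; apply: rt_refl.
- have [v' wv' /IHu[u' vu' Zu]] := IHv w' Zw.
  by exists u' => //; apply: rt_trans vu'.
Qed.

Lemma simulation_restriction M N (Z : world M -> world N -> Prop)
    (P : set (world M)) (Q : set (world N)) :
  simulation Z -> (forall w w', Z w w' -> P w -> Q w') ->
  simulation (M := restriction P) (N := restriction Q)
    (fun w w' => Z (sval w) (sval w')).
Proof.
move=> simZ PQ a [w Pw] [u Pu] [w' Qw'] /= Zw wu.
have [u' wu' Zu] := simZ a w u w' Zw wu.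
by exists (exist _ u' (PQ _ _ Zu Pu)).
Qed.

Lemma pal_sat_bisimulation (phi : pal AP Ag) M N (Z : world M -> world N -> Prop)
    w w' :
  bisimulation Z -> Z w w' -> (pal_sat phi M w <-> pal_sat phi N w').
Proof.
elim: phi M N Z w w' => [p|psi IH|psi IHpsi chi IHchi|A psi IH|psi IHpsi chi IHchi]
  M N Z w w' bZ Zw /=; have [atomZ simZ simZ'] := bZ.
- exact: atomZ.
- by split=> npsi /(IH _ _ _ _ _ bZ Zw).
- by split=> -[/(IHpsi _ _ _ _ _ bZ Zw) ? /(IHchi _ _ _ _ _ bZ Zw)].
- split=> CA u.
  + move=> /(simulation_common simZ')/(_ w Zw)[v /CA psiv Zv].
    exact/(IH _ _ _ _ _ bZ Zv).
  + move=> /(simulation_common simZ)/(_ w' Zw)[v /CA psiv Zv].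
    exact/(IH _ _ _ _ _ bZ Zv).
(* The induction hypothesis for [psi] matches the two domains, so [Z] restricts to a bisimulation
   between the restricted models; this is why the models and the relation vary in the induction. *)
- have bZpsi : bisimulation (M := restriction (pal_sat psi M))
      (N := restriction (pal_sat psi N)) (fun v v' => Z (sval v) (sval v')).
    split=> [p v v' Zv||]; first exact: atomZ.
    + by apply: (simulation_restriction simZ) => v v' /(IHpsi _ _ _ _ _ bZ)[].
    + by apply: (simulation_restriction simZ') => v' v /(IHpsi _ _ _ _ _ bZ)[].
  have IH h h' : pal_sat chi (restriction (pal_sat psi M)) (exist _ w h) <->
      pal_sat chi (restriction (pal_sat psi N)) (exist _ w' h').
    exact: (IHchi _ _ _ _ _ bZpsi).
  split=> H h.
  + by apply/(IH ((IHpsi _ _ _ _ _ bZ Zw).2 h))/H.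
  + by apply/(IH h ((IHpsi _ _ _ _ _ bZ Zw).1 h))/H.
Qed.

Lemma refined_accE M (A : {set Ag}) (S : Ag -> set (world M)) (P : set (world M))
    a v u : a \in A ->
  refined_acc A S P a v u <-> acc M a v u /\ (S a v -> (P v <-> P u)).
Proof.
rewrite /refined_acc => ->.
have [Sv|nSv] := pselect (S a v); last first.
  by rewrite !memNset; [split=> [|[]]|case|case].
have [Pv|nPv] := pselect (P v).
  by rewrite mem_set //; split=> [[? ?]|[? /(_ Sv)[H _]]]; split=> //; exact: H.
rewrite memNset; last by case.
rewrite mem_set //; split=> [[vu nPu]|[vu /(_ Sv)[_ H]]]; first by split.
by split=> // /H.
Qed.

Lemma refined_acc_notin M (A : {set Ag}) (S : Ag -> set (world M))
    (P : set (world M)) a v :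
  a \notin A -> refined_acc A S P a v = acc M a v.
Proof. by rewrite /refined_acc => /negbTE ->. Qed.

(** Every world reachable from [w] in [M] lies in the refined region, where an edge survives exactly
    when its ends agree on [P]; so edges leaving [P]-worlds stay in [P], as in the restriction. *)
Lemma restriction_global_bisimulation M (w : world M) (P : set (world M)) :
  bisimulation (M := restriction P) (N := global_refinement w P [set: Ag])
    (fun v u => sval v = u /\ common_acc [set: Ag] w u).
Proof.
split=> [p [v Pv] u [/= <- _]//||].
- move=> a [v Pv] [u Pu] v' [/= <- wv] vu; exists u.
    by apply/refined_accE; [rewrite inE|split].
  by split=> //; apply: common_acc_closed vu wv; rewrite inE.
- move=> a v u [v' Pv] [/= <- wv] /refined_accE[|vu /(_ wv)[Pu _]].
    by rewrite inE.
  exists (exist _ u (Pu Pv)) => //; split=> //.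
  by apply: common_acc_closed vu wv; rewrite inE.
Qed.

Fixpoint glal_of_pal (phi : pal AP Ag) : glal AP Ag :=
  match phi with
  | PAtom p => GAtom Ag p
  | PNeg psi => GNeg (glal_of_pal psi)
  | PAnd psi chi => GAnd (glal_of_pal psi) (glal_of_pal chi)
  | PCommon A psi => GCommon A (glal_of_pal psi)
  | PPublic psi chi => GGlobal [set: Ag] (glal_of_pal psi) (glal_of_pal chi)
  end.

Lemma glal_sat_of_pal (phi : pal AP Ag) M :
  glal_sat (glal_of_pal phi) M = pal_sat phi M.
Proof.
elim: phi M => [p|psi IH|psi IHpsi chi IHchi|A psi IH|psi IHpsi chi IHchi] M /=.
- by [].
- by rewrite IH.
- by rewrite IHpsi IHchi.
- by rewrite IH.
have E w h : pal_sat chi (restriction (pal_sat psi M)) (exist _ w h) <->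
    pal_sat chi (global_refinement w (pal_sat psi M) [set: Ag]) w.
  apply: (pal_sat_bisimulation _ (restriction_global_bisimulation w _)).
  by split=> //; apply: rt_refl.
by rewrite IHpsi; apply/seteqP; split=> w /= H h; have := H h; rewrite IHchi => /E.
Qed.

Definition two_worlds : model AP Ag.
Proof.
by refine {| world := bool; acc := fun _ _ => setT; valuation := fun _ v => v |};
  split.
Defined.

(* World (i, v) has truth value v and lies in the i-th copy of [two_worlds]; the
   agents other than [a] link each world to the opposite one in the other copy. *)
Definition two_copies (a : Ag) : model AP Ag.
Proof.
refine {| world := bool * bool;
  acc := fun c x y => if c == a then x.1 = y.1 else x.1 (+) x.2 = y.1 (+) y.2;
  valuation := fun _ x => x.2 |}.
by move=> c; case: (c == a); split=> [x|x y z ->|x y ->].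
Defined.

Lemma two_worlds_copies_bisimulation a :
  bisimulation (M := two_worlds) (N := two_copies a) (fun v x => v = x.2).
Proof.
split=> [p v x -> //|c v u [i _] /= <- _|c x y v _ _]; last by exists y.2.
(* For [a] the copy [i] is kept; for the other agents the copy is chosen so that the xor of the two
   coordinates is preserved. *)
exists (if c == a then i else i (+) v (+) u, u) => //=.
by case: (c == a) => //; rewrite -addbA addbb addbF.
Qed.

(* [p]^-_a C_b (p \/ C_a ~ p), with the disjunction expanded. *)
Definition local_announcement (p : AP) (a b : Ag) : glal AP Ag :=
  GLocal [set a] (GAtom Ag p) (GCommon [set b]
    (GNeg (GAnd (GNeg (GAtom Ag p)) (GNeg (GCommon [set a] (GNeg (GAtom Ag p))))))).

Lemma two_worlds_local_announcement p a b :
  glal_sat (local_announcement p a b) two_worlds true.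
Proof.
move=> /= _ v _ [nv]; apply=> u vu; elim: vu nv => // {v u} [v u|v u t _ IHu _ IHt].
  by case=> c ca /refined_accE[//|_ /(_ I)[_ uv]] nv /uv.
by move=> /IHu /IHt.
Qed.

Lemma two_copies_local_announcement p a b : a != b ->
  ~ glal_sat (local_announcement p a b) (two_copies a) (false, true).
Proof.
(* The world [(true, false)] has the same xor as [(false, true)], so [b] reaches it; it lies in the
   copy left unsplit, where [a] still leads to the [p]-world [(true, true)]. *)
move=> ab /(_ isT)/(_ (true, false)) /=; apply.
  apply: rt_step; exists b; first by rewrite inE.
  by rewrite /= refined_acc_notin ?inE /= eq_sym (negbTE ab).
split=> // /(_ (true, true)); apply=> //.
apply: rt_step; exists a; first by rewrite inE.
by apply/refined_accE; rewrite ?inE //= eqxx.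
Qed.

End Bisimulation.

Theorem corollary7 (AP : Type) (Ag : finType) :
  (forall phi : pal AP Ag, exists psi : glal AP Ag, equivalent phi psi) /\
  (inhabited AP -> 1 < #|Ag| ->
     exists psi : glal AP Ag, forall phi : pal AP Ag, ~ equivalent phi psi).
Proof.
split=> [phi|[p] /card_gt1P[a [b [_ _ ab]]]].
  by exists (glal_of_pal phi) => M w; rewrite glal_sat_of_pal.
exists (local_announcement p a b) => phi eq_phi.
apply: (two_copies_local_announcement (p := p) ab); apply/eq_phi.
(* The bisimulation relates [true] to [(false, true)], so [phi] would carry the truth of the
   announcement across. *)
have [two_copies_phi _] := pal_sat_bisimulation phi
  (two_worlds_copies_bisimulation a) (erefl : true = (false, true).2).
exact/two_copies_phi/eq_phi/two_worlds_local_announcement.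
Qed.
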